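(* The generating function $g\left(\mathbf{Q}W_{n}(s);\lambda\right)=\sum_{n\geq 0}\mathbf{Q}W_{n}(s)\lambda^{n}$ of the higher order Horadam 3-parameter generalized quaternions has the form $$g\left(\mathbf{Q}W_{n}(s);\lambda\right)=\frac{A\Theta_{\alpha}(s)-B\Theta_{\beta}(s)-\left[A\beta^{s}\Theta_{\alpha}(s)-B\alpha^{s}\Theta_{\beta}(s)\right]\lambda}{\left[A\alpha^{s}-B\beta^{s}\right]\left[1-(\alpha^{s}+\beta^{s})\lambda+(\alpha\beta)^{s}\lambda^{2}\right]}.$$
   Context: Let $\alpha,\beta$ be distinct nonzero real numbers, $W_0,W_1$ real numbers, $A=W_1-W_0\beta$, $B=W_1-W_0\alpha$, and let $W_n=\frac{A\alpha^n-B\beta^n}{\alpha-\beta}$ ($n\geq 0$) be the Horadam numbers. Fix an integer $s\geq 1$ with $W_s\neq 0$, equivalently $A\alpha^s-B\beta^s\neq 0$. The higher order Horadam numbers are $W_n(s)=\frac{W_{sn}}{W_s}=\frac{A\alpha^{sn}-B\beta^{sn}}{A\alpha^s-B\beta^s}$, $n\geq 0$. Let $\lambda_1,\lambda_2,\lambda_3$ be real parameters. The 3-parameter generalized quaternions form the real algebra of elements $x_0\mathbf{1}+x_1\mathbf{i}+x_2\mathbf{j}+x_3\mathbf{k}$ ($x_r\in\mathbb{R}$) with basis $\mathbf{1},\mathbf{i},\mathbf{j},\mathbf{k}$ and bilinear multiplication in which $\mathbf{1}$ is the identity and $\mathbf{i}^2=-\lambda_1\lambda_2\mathbf{1}$,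 $\mathbf{j}^2=-\lambda_1\lambda_3\mathbf{1}$, $\mathbf{k}^2=-\lambda_2\lambda_3\mathbf{1}$, $\mathbf{i}\mathbf{j}=\lambda_1\mathbf{k}=-\mathbf{j}\mathbf{i}$, $\mathbf{j}\mathbf{k}=\lambda_3\mathbf{i}=-\mathbf{k}\mathbf{j}$, $\mathbf{k}\mathbf{i}=\lambda_2\mathbf{j}=-\mathbf{i}\mathbf{k}$. The higher order Horadam 3-parameter generalized quaternions are $\mathbf{Q}W_n(s)=W_n(s)\mathbf{1}+W_{n+1}(s)\mathbf{i}+W_{n+2}(s)\mathbf{j}+W_{n+3}(s)\mathbf{k}$, $n\geq 0$. Put $\Theta_{\alpha}(s)=\mathbf{1}+\alpha^{s}\mathbf{i}+\alpha^{2s}\mathbf{j}+\alpha^{3s}\mathbf{k}$ and $\Theta_{\beta}(s)=\mathbf{1}+\beta^{s}\mathbf{i}+\beta^{2s}\mathbf{j}+\beta^{3s}\mathbf{k}$. The generating function is a formal power series in an indeterminate $\lambda$ commuting with the quaternions (unrelated to $\lambda_1,\lambda_2,\lambda_3$), and the identity is one of formal power series. *)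

(* Defs.v *)
From HB Require Import structures.
From mathcomp Require Import all_boot all_order all_algebra.
From mathcomp Require Import ring.
From mathcomp Require Import boolp reals.

Set Implicit Arguments.
Unset Strict Implicit.
Unset Printing Implicit Defensive.

Import GRing.Theory.
Local Open Scope ring_scope.

(* The parameters l1, l2, l3 do not occur in the fields: they select the
   multiplication [mulgq]. *)
Record gquat (R : Type) (l1 l2 l3 : R) :=
  GQuat { gq0 : R; gq1 : R; gq2 : R; gq3 : R }.

Arguments GQuat {R} l1 l2 l3 _ _ _ _.

Section GQuat.
Variables (R : fieldType) (l1 l2 l3 : R).

Local Notation H := (gquat l1 l2 l3).
Local Notation Q := (GQuat l1 l2 l3).

Definition gq_tuple (x : H) : R * R * R * R := (gq0 x, gq1 x, gq2 x, gq3 x).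
Definition tuple_gq (t : R * R * R * R) : H :=
  let: (a, b, c, d) := t in Q a b c d.
Fact gq_tupleK : cancel gq_tuple tuple_gq. Proof. by case. Qed.

HB.instance Definition _ := Choice.copy H (can_type gq_tupleK).

Definition addgq (x y : H) : H :=
  Q (gq0 x + gq0 y) (gq1 x + gq1 y) (gq2 x + gq2 y) (gq3 x + gq3 y).
Definition oppgq (x : H) : H := Q (- gq0 x) (- gq1 x) (- gq2 x) (- gq3 x).

Fact addgqA : associative addgq.
Proof. by move=> x y z; rewrite /addgq /= !addrA. Qed.
Fact addgqC : commutative addgq.
Proof. by move=> x y; congr (Q _ _ _ _); apply: addrC. Qed.
Fact add0gq : left_id (Q 0 0 0 0) addgq.
Proof. by case=> *; rewrite /addgq /= !add0r. Qed.
Fact addNgq : left_inverse (Q 0 0 0 0) oppgq addgq.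
Proof. by move=> x; rewrite /addgq /= !addNr. Qed.

HB.instance Definition _ :=
  GRing.isZmodule.Build H addgqA addgqC add0gq addNgq.

Definition scalegq (c : R) (x : H) : H :=
  Q (c * gq0 x) (c * gq1 x) (c * gq2 x) (c * gq3 x).

Fact scalegqA a b x : scalegq a (scalegq b x) = scalegq (a * b) x.
Proof. by rewrite /scalegq /= !mulrA. Qed.
Fact scale1gq : left_id 1 scalegq.
Proof. by case=> *; rewrite /scalegq /= !mul1r. Qed.
Fact scalegqDr : right_distributive scalegq +%R.
Proof. by move=> c x y; rewrite /scalegq /= !mulrDr. Qed.
Fact scalegqDl x : {morph scalegq^~ x : a b / a + b}.
Proof. by move=> a b; rewrite /scalegq /= !mulrDl. Qed.

HB.instance Definition _ :=
  GRing.Zmodule_isLmodule.Build R H scalegqA scale1gq scalegqDr scalegqDl.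

(* The bilinear extension of the multiplication table that [gqiM], ..., [gqikM]
   recover below. *)
Definition mulgq (x y : H) : H :=
  Q (gq0 x * gq0 y - l1 * l2 * (gq1 x * gq1 y)
       - l1 * l3 * (gq2 x * gq2 y) - l2 * l3 * (gq3 x * gq3 y))
    (gq0 x * gq1 y + gq1 x * gq0 y + l3 * (gq2 x * gq3 y - gq3 x * gq2 y))
    (gq0 x * gq2 y + gq2 x * gq0 y + l2 * (gq3 x * gq1 y - gq1 x * gq3 y))
    (gq0 x * gq3 y + gq3 x * gq0 y + l1 * (gq1 x * gq2 y - gq2 x * gq1 y)).

Fact mulgqA : associative mulgq.
Proof. by move=> x y z; rewrite /mulgq /=; congr (Q _ _ _ _); ring. Qed.
Fact mul1gq : left_id (Q 1 0 0 0) mulgq.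
Proof. by case=> a b c d; rewrite /mulgq /=; congr (Q _ _ _ _); ring. Qed.
Fact mulgq1 : right_id (Q 1 0 0 0) mulgq.
Proof. by case=> a b c d; rewrite /mulgq /=; congr (Q _ _ _ _); ring. Qed.
Fact mulgqDl : left_distributive mulgq addgq.
Proof.
by move=> x y z; rewrite /mulgq /addgq /=; congr (Q _ _ _ _); ring.
Qed.
Fact mulgqDr : right_distributive mulgq addgq.
Proof.
by move=> x y z; rewrite /mulgq /addgq /=; congr (Q _ _ _ _); ring.
Qed.
Fact gq1_neq0 : Q 1 0 0 0 != Q 0 0 0 0.
Proof. by apply/eqP=> -[/eqP]; rewrite oner_eq0. Qed.

HB.instance Definition _ := GRing.Zmodule_isNzRing.Build H
  mulgqA mul1gq mulgq1 mulgqDl mulgqDr gq1_neq0.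

Fact scalegqAl (c : R) (x y : H) : c *: (x * y) = (c *: x) * y.
Proof.
rewrite /GRing.scale /GRing.mul /= /scalegq /mulgq /=.
by congr (Q _ _ _ _); ring.
Qed.
HB.instance Definition _ := GRing.Lmodule_isLalgebra.Build R H scalegqAl.

Fact scalegqAr (c : R) (x y : H) : c *: (x * y) = x * (c *: y).
Proof.
rewrite /GRing.scale /GRing.mul /= /scalegq /mulgq /=.
by congr (Q _ _ _ _); ring.
Qed.
HB.instance Definition _ := GRing.Lalgebra_isAlgebra.Build R H scalegqAr.

Definition gqi : H := Q 0 1 0 0.
Definition gqj : H := Q 0 0 1 0.
Definition gqk : H := Q 0 0 0 1.

Lemma gquatE (x : H) :
  x = gq0 x *: 1 + gq1 x *: gqi + gq2 x *: gqj + gq3 x *: gqk.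
Proof.
case: x => a b c d.
rewrite /GRing.scale /GRing.add /GRing.one /= /scalegq /addgq /=.
by congr (Q _ _ _ _); ring.
Qed.

Let gqEs : ((@GRing.mul H = mulgq) * (@GRing.scale R H = scalegq)
  * (@GRing.opp H = oppgq) * (1 = Q 1 0 0 0 :> H))%type.
Proof. by []. Qed.

Ltac gq_crush :=
  rewrite ?gqEs /mulgq /scalegq /oppgq /=; congr (Q _ _ _ _); ring.

Lemma gqiM : gqi * gqi = - (l1 * l2) *: 1. Proof. gq_crush. Qed.
Lemma gqjM : gqj * gqj = - (l1 * l3) *: 1. Proof. gq_crush. Qed.
Lemma gqkM : gqk * gqk = - (l2 * l3) *: 1. Proof. gq_crush. Qed.
Lemma gqijM : gqi * gqj = l1 *: gqk. Proof. gq_crush. Qed.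
Lemma gqjiM : gqj * gqi = - (l1 *: gqk). Proof. gq_crush. Qed.
Lemma gqjkM : gqj * gqk = l3 *: gqi. Proof. gq_crush. Qed.
Lemma gqkjM : gqk * gqj = - (l3 *: gqi). Proof. gq_crush. Qed.
Lemma gqkiM : gqk * gqi = l2 *: gqj. Proof. gq_crush. Qed.
Lemma gqikM : gqi * gqk = - (l2 *: gqj). Proof. gq_crush. Qed.

(* Units: [x] is invertible iff its norm [x * conjgq x] is nonzero. *)
Definition conjgq (x : H) : H := Q (gq0 x) (- gq1 x) (- gq2 x) (- gq3 x).
Definition normgq (x : H) : R :=
  gq0 x ^+ 2 + l1 * l2 * gq1 x ^+ 2 + l1 * l3 * gq2 x ^+ 2
  + l2 * l3 * gq3 x ^+ 2.

Lemma mulgq_conj (x : H) : x * conjgq x = (normgq x)%:A.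
Proof. rewrite /normgq /conjgq; gq_crush. Qed.
Lemma mulconj_gq (x : H) : conjgq x * x = (normgq x)%:A.
Proof. rewrite /normgq /conjgq; gq_crush. Qed.

Definition unitgq : pred H := fun x => normgq x != 0.
Definition invgq (x : H) : H :=
  if unitgq x then (normgq x)^-1 *: conjgq x else x.

Fact mulVgq : {in unitgq, left_inverse 1 invgq *%R}.
Proof.
move=> x ux; rewrite /invgq; have -> : unitgq x by [].
by rewrite -scalerAl mulconj_gq scalerA mulVf // scale1r.
Qed.
Fact mulgqV : {in unitgq, right_inverse 1 invgq *%R}.
Proof.
move=> x ux; rewrite /invgq; have -> : unitgq x by [].
by rewrite -scalerAr mulgq_conj scalerA mulVf // scale1r.
Qed.
Fact unitgqP (x y : H) : y * x = 1 /\ x * y = 1 -> unitgq x.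
Proof.
case=> yx _; apply/eqP=> nx0.
have cx0 : conjgq x = 0 by rewrite -[conjgq x]mul1r -yx -mulrA mulgq_conj nx0
  scale0r mulr0.
have x0 : x = 0.
  case: (x) cx0 => a b c d [-> /eqP + /eqP + /eqP].
  by rewrite !oppr_eq0 => /eqP -> /eqP -> /eqP ->.
by move/eqP: yx; rewrite x0 mulr0 eq_sym oner_eq0.
Qed.
Fact invgq_out : {in [predC unitgq], invgq =1 id}.
Proof. by move=> x /negbTE ux; rewrite /invgq; have -> : unitgq x = false. Qed.

HB.instance Definition _ :=
  GRing.NzRing_hasMulInverse.Build H mulVgq mulgqV unitgqP invgq_out.

End GQuat.

Record fps (T : Type) := Fps { fpscoef : nat -> T }.

Section FpsBase.
Variable T : Type.
HB.instance Definition _ := gen_eqMixin (fps T).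
HB.instance Definition _ := gen_choiceMixin (fps T).

Lemma fpsP (a b : fps T) : fpscoef a =1 fpscoef b -> a = b.
Proof. by case: a b => [a] [b] /= /funext ->. Qed.
End FpsBase.

Section FpsZmodule.
Variable V : zmodType.
Implicit Types a b c : fps V.

Definition fps0 : fps V := Fps (fun=> 0).
Definition addfps a b := Fps (fun n => fpscoef a n + fpscoef b n).
Definition oppfps a := Fps (fun n => - fpscoef a n).

Fact addfpsA : associative addfps.
Proof. by move=> a b c; apply: fpsP => n; apply: addrA. Qed.
Fact addfpsC : commutative addfps.
Proof. by move=> a b; apply: fpsP => n; apply: addrC. Qed.
Fact add0fps : left_id fps0 addfps.
Proof. by move=> a; apply: fpsP => n; apply: add0r. Qed.
Fact addNfps : left_inverse fps0 oppfps addfps.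
Proof. by move=> a; apply: fpsP => n; apply: addNr. Qed.

HB.instance Definition _ :=
  GRing.isZmodule.Build (fps V) addfpsA addfpsC add0fps addNfps.
End FpsZmodule.

Section FpsLmodule.
Variables (R : pzRingType) (V : lmodType R).

Definition scalefps (c : R) (a : fps V) : fps V :=
  Fps (fun n => c *: fpscoef a n).

Fact scalefpsA c d a : scalefps c (scalefps d a) = scalefps (c * d) a.
Proof. by apply: fpsP => n; apply: scalerA. Qed.
Fact scale1fps : left_id 1 scalefps.
Proof. by move=> a; apply: fpsP => n; apply: scale1r. Qed.
Fact scalefpsDr : right_distributive scalefps +%R.
Proof. by move=> c a b; apply: fpsP => n; apply: scalerDr. Qed.
Fact scalefpsDl a : {morph scalefps^~ a : c d / c + d}.
Proof. by move=> c d; apply: fpsP => n; apply: scalerDl. Qed.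

HB.instance Definition _ := GRing.Zmodule_isLmodule.Build R (fps V)
  scalefpsA scale1fps scalefpsDr scalefpsDl.
End FpsLmodule.

Section FpsRing.
Variable T : nzRingType.
Implicit Types a b c : fps T.

Definition fpsC (x : T) : fps T := Fps (fun n => if n == 0%N then x else 0).
Definition fpsX : fps T := Fps (fun n => (n == 1%N)%:R).

Definition mulfps a b : fps T :=
  Fps (fun n => \sum_(i < n.+1) fpscoef a i * fpscoef b (n - i)%N).

Definition fpstrunc (N : nat) a : {poly T} := \poly_(i < N.+1) fpscoef a i.

Lemma coef_fpstrunc N a i : (i <= N)%N -> (fpstrunc N a)`_i = fpscoef a i.
Proof. by move=> iN; rewrite coef_poly ltnS iN. Qed.

Lemma mulfps_trunc N a b n : (n <= N)%N ->
  fpscoef (mulfps a b) n = (fpstrunc N a * fpstrunc N b)`_n.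
Proof.
move=> nN; rewrite coefM; apply: eq_bigr => i _.
rewrite !coef_fpstrunc ?(leq_trans (leq_subr _ _)) //.
by apply: leq_trans nN; rewrite -ltnS.
Qed.

Fact mulfpsA : associative mulfps.
Proof.
move=> a b c; apply: fpsP => n.
transitivity (fpstrunc n a * (fpstrunc n b * fpstrunc n c))`_n.
  rewrite coefM; apply: eq_bigr => i _.
  by rewrite -mulfps_trunc ?leq_subr // coef_fpstrunc // -ltnS.
rewrite mulrA coefM; apply: eq_bigr => i _.
by rewrite -mulfps_trunc -1?ltnS // coef_fpstrunc // leq_subr.
Qed.

Fact mul1fps : left_id (fpsC 1) mulfps.
Proof.
move=> a; apply: fpsP => n /=; rewrite big_ord_recl /= subn0 mul1r.
by rewrite big1 ?addr0 // => i _; rewrite mul0r.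
Qed.
Fact mulfps1 : right_id (fpsC 1) mulfps.
Proof.
move=> a; apply: fpsP => n /=; rewrite big_ord_recr /= subnn mulr1.
rewrite big1 ?add0r // => i _; rewrite subn_eq0 leqNgt ltn_ord /=.
by rewrite mulr0.
Qed.
Fact mulfpsDl : left_distributive mulfps +%R.
Proof.
move=> a b c; apply: fpsP => n /=; rewrite -big_split /=.
by apply: eq_bigr => i _; rewrite mulrDl.
Qed.
Fact mulfpsDr : right_distributive mulfps +%R.
Proof.
move=> a b c; apply: fpsP => n /=; rewrite -big_split /=.
by apply: eq_bigr => i _; rewrite mulrDr.
Qed.
Fact fps1_neq0 : fpsC 1 != 0.
Proof.
by apply/eqP=> /(congr1 (fun a => fpscoef a 0%N)) /eqP; rewrite /= oner_eq0.
Qed.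

HB.instance Definition _ := GRing.Zmodule_isNzRing.Build (fps T)
  mulfpsA mul1fps mulfps1 mulfpsDl mulfpsDr fps1_neq0.

Lemma coef_fpsM a b n :
  fpscoef (a * b) n = \sum_(i < n.+1) fpscoef a i * fpscoef b (n - i)%N.
Proof. by []. Qed.
Lemma coef_fps1 n : fpscoef (1 : fps T) n = (n == 0%N)%:R.
Proof. by case: n. Qed.

Lemma fpsXM a : fpsX * a = a * fpsX.
Proof.
apply: fpsP => n; rewrite !coef_fpsM /=.
rewrite (reindex_inj rev_ord_inj) /=; apply: eq_bigr => i _.
rewrite subSS subKn -1?ltnS //.
by case: eqP => _; rewrite ?mul1r ?mulr1 ?mul0r ?mulr0.
Qed.

Lemma coef_fpsXn k n : fpscoef (fpsX ^+ k) n = (n == k)%:R.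
Proof.
elim: k n => [|k IHk] n; first by rewrite expr0 coef_fps1.
rewrite exprS coef_fpsM; case: n => [|n].
  by rewrite big_ord1 /= mul0r.
rewrite big_ord_recl /= mul0r add0r big_ord_recl /= mul1r subn1 IHk eqSS.
by rewrite big1 ?addr0 // => i _; rewrite mul0r.
Qed.
End FpsRing.

Arguments fpsX {T}.

Section FpsAlgebra.
Variables (R : pzRingType) (T : algType R).

Fact scalefpsAl (c : R) (a b : fps T) : c *: (a * b) = (c *: a) * b.
Proof.
apply: fpsP => n; rewrite /= scaler_sumr.
by apply: eq_bigr => i _; rewrite scalerAl.
Qed.
HB.instance Definition _ := GRing.Lmodule_isLalgebra.Build R (fps T) scalefpsAl.

Fact scalefpsAr (c : R) (a b : fps T) : c *: (a * b) = a * (c *: b).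
Proof.
apply: fpsP => n; rewrite /= scaler_sumr.
by apply: eq_bigr => i _; rewrite scalerAr.
Qed.
HB.instance Definition _ := GRing.Lalgebra_isAlgebra.Build R (fps T) scalefpsAr.
End FpsAlgebra.

Section FpsUnit.
Variable T : unitRingType.
Implicit Types a b : fps T.

Definition unitfps : pred (fps T) := fun a => fpscoef a 0%N \is a GRing.unit.

(* The first [n] coefficients of the inverse of [a], by the recursion
   b_m = a_0^-1 ([m = 0] - \sum_(i < m) a_(m-i) b_i). *)
Fixpoint invfps_seq a (n : nat) : seq T :=
  if n is m.+1 then
    let r := invfps_seq a m in
    rcons r ((fpscoef a 0)^-1
             * ((m == 0%N)%:R - \sum_(i < m) fpscoef a (m - i)%N * r`_i))
  else [::].

Definition invfps a : fps T :=
  if unitfps a then Fps (fun n => (invfps_seq a n.+1)`_n) else a.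

Lemma size_invfps_seq a n : size (invfps_seq a n) = n.
Proof. by elim: n => //= n IHn; rewrite size_rcons IHn. Qed.

Lemma nth_invfps_seq a n i :
  (i < n)%N -> (invfps_seq a n)`_i = (invfps_seq a i.+1)`_i.
Proof.
elim: n => // n IHn; rewrite ltnS leq_eqVlt => /orP[/eqP -> //|iltn].
by rewrite -(IHn iltn) [in LHS]/= nth_rcons size_invfps_seq iltn.
Qed.

Lemma coef_invfps a n : unitfps a -> fpscoef (invfps a) n =
  (fpscoef a 0)^-1 * ((n == 0%N)%:R
    - \sum_(i < n) fpscoef a (n - i)%N * fpscoef (invfps a) i).
Proof.
move=> ua; rewrite /invfps ua [LHS]/= nth_rcons size_invfps_seq ltnn eqxx.
congr (_ * (_ - _)); apply: eq_bigr => i _.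
by rewrite (@nth_invfps_seq a n).
Qed.

Fact mulfpsV : {in unitfps, right_inverse 1 invfps *%R}.
Proof.
move=> a ua; apply: fpsP => n; rewrite coef_fpsM coef_fps1.
rewrite (reindex_inj rev_ord_inj) big_ord_recr /= subSS subnn subn0.
rewrite coef_invfps // mulVKr //.
apply/eqP; rewrite addrC -subr_eq0 [X in X == _](_ : _ = 0) //.
rewrite [X in _ + X - _](_ : _ =
  \sum_(i < n) fpscoef a (n - i)%N * fpscoef (invfps a) i).
  by rewrite subrK subrr.
by apply: eq_bigr => i _; rewrite subSS subKn // ltnW.
Qed.

Fact mulVfps : {in unitfps, left_inverse 1 invfps *%R}.
Proof.
move=> a ua; set b := invfps a.
have ab1 : a * b = 1 by apply: mulfpsV.
have ub : unitfps b.
  by rewrite /unitfps coef_invfps // big_ord0 subr0 mulr1 unitrV.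
by rewrite -[RHS](mulfpsV ub); congr (b * _);
  rewrite -[LHS]mulr1 -(mulfpsV ub) mulrA ab1 mul1r.
Qed.

Fact unitfpsP (a b : fps T) : b * a = 1 /\ a * b = 1 -> unitfps a.
Proof.
case=> /(congr1 (fun u => fpscoef u 0%N)) + /(congr1 (fun u => fpscoef u 0%N)).
rewrite /= !big_ord1 !subn0 => ba ab.
by apply/unitrP; exists (fpscoef b 0%N).
Qed.

Fact invfps_out : {in [predC unitfps], invfps =1 id}.
Proof. by move=> a /negbTE ua; rewrite /invfps; have -> : unitfps a = false. Qed.

HB.instance Definition _ :=
  GRing.NzRing_hasMulInverse.Build (fps T) mulVfps mulfpsV unitfpsP invfps_out.
End FpsUnit.

HB.instance Definition _ (R : pzRingType) (T : unitAlgType R) :=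
  GRing.UnitRing.on (fps T).

Section Horadam.
Variable R : realType.
Variables (l1 l2 l3 : R) (alpha beta W0 W1 : R).

Definition horadam (n : nat) : R :=
  ((W1 - W0 * beta) * alpha ^+ n - (W1 - W0 * alpha) * beta ^+ n)
  / (alpha - beta).

Definition ho_horadam (s n : nat) : R := horadam (s * n)%N / horadam s.

Definition ho_horadam_gquat (s n : nat) : gquat l1 l2 l3 :=
  ho_horadam s n *: 1 + ho_horadam s n.+1 *: gqi l1 l2 l3
  + ho_horadam s n.+2 *: gqj l1 l2 l3 + ho_horadam s n.+3 *: gqk l1 l2 l3.

(* \sum_(n >= 0) QW_n(s) X^n, given by its coefficients. *)
Definition horadam_gf (s : nat) : fps (gquat l1 l2 l3) :=
  Fps (ho_horadam_gquat s).

Definition Theta (x : R) (s : nat) : gquat l1 l2 l3 :=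
  1 + x ^+ s *: gqi l1 l2 l3 + x ^+ (2 * s) *: gqj l1 l2 l3
  + x ^+ (3 * s) *: gqk l1 l2 l3.

End Horadam.

(* Main.v *)
(* Put p = alpha^s, q = beta^s and c = A p - B q.  By the Binet form,
   QW_n(s) = c^-1 (A p^n Theta_alpha - B q^n Theta_beta), so the generating
   function is a combination of two geometric series v / (1 - r x), and the
   denominator factors as c (1 - p x) (1 - q x). *)
Require Import Defs.
From mathcomp Require Import all_boot all_order all_algebra.
From mathcomp Require Import ring reals.

Set Implicit Arguments.
Unset Strict Implicit.
Unset Printing Implicit Defensive.

Import GRing.Theory.
Local Open Scope ring_scope.

Lemma coef_fpsMX (T : nzRingType) (a : fps T) (n : nat) :
  fpscoef (a * fpsX) n = if n is m.+1 then fpscoef a m else 0.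
Proof.
rewrite -fpsXM coef_fpsM; case: n => [|n].
  by rewrite big_ord1 /= mul0r.
rewrite big_ord_recl /= mul0r add0r big_ord_recl /= mul1r subn1 /=.
by rewrite big1 ?addr0 // => i _; rewrite mul0r.
Qed.

(** The ratio is a scalar, hence central, while the numerator [v] may be any vector; this is the
    expansion of v / (1 - r x). *)
Definition fps_geom (R : pzRingType) (V : lmodType R) (r : R) (v : V) : fps V :=
  Fps (fun n => r ^+ n *: v).

(** Telescoping: past the constant term, each coefficient is [r ^+ n.+1 *: v] minus itself. *)
Lemma fps_geomM (R : nzRingType) (T : algType R) (r : R) (v : T) :
  fps_geom r v * (1 - r *: fpsX) = fpsC v.
Proof.
rewrite mulrBr mulr1 -scalerAr; apply: fpsP => n.
change (r ^+ n *: v - r *: fpscoef (fps_geom r v * fpsX) n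
        = if n == 0%N then v else 0).
rewrite coef_fpsMX; case: n => [|n] /=.
  by rewrite expr0 scale1r scaler0 subr0.
by rewrite scalerA -exprS subrr.
Qed.

Lemma fps_linear_factorsM (R : comNzRingType) (T : algType R) (p q : R) :
  (1 - p *: fpsX) * (1 - q *: fpsX)
  = 1 - (p + q) *: fpsX + (p * q) *: fpsX ^+ 2 :> fps T.
Proof.
rewrite mulrBr mulr1 mulrBl mul1r -scalerAl -scalerAr scalerA -expr2.
by rewrite opprB scalerDl opprD !addrA [LHS]addrAC.
Qed.

(** Invertibility of a series is decided by its constant coefficient, which here is 1. *)
Lemma unit_fps_linear (R : nzRingType) (T : unitAlgType R) (r : R) :
  (1 - r *: fpsX : fps T) \is a GRing.unit.
Proof.
change ((1 - r *: 0 : T) \is a GRing.unit).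
by rewrite scaler0 subr0 unitr1.
Qed.

Lemma fpsCB_scale (R : nzRingType) (T : algType R) (a b : R) (u v : T) :
  fpsC (a *: u - b *: v) = a *: fpsC u - b *: fpsC v.
Proof. by apply: fpsP => -[|n] //=; rewrite !scaler0 subrr. Qed.

Lemma ThetaE (R : realType) (l1 l2 l3 x : R) (s : nat) :
  Theta l1 l2 l3 x s = GQuat l1 l2 l3 1 (x ^+ s) (x ^+ (2 * s)) (x ^+ (3 * s)).
Proof. by rewrite [RHS]gquatE /= scale1r. Qed.

Section Binet.
Variables (R : realType) (l1 l2 l3 alpha beta W0 W1 : R) (s : nat).
Hypotheses (neq_ab : alpha != beta) (Ws0 : horadam alpha beta W0 W1 s != 0).
Let A := W1 - W0 * beta.
Let B := W1 - W0 * alpha.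
Let p := alpha ^+ s.
Let q := beta ^+ s.
Let c := A * p - B * q.

Lemma horadam_num_neq0 : c != 0.
Proof.
apply: contraNneq Ws0; rewrite /horadam -/A -/B -/p -/q -/c => ->.
by rewrite mul0r.
Qed.

(** The factor [alpha - beta] cancels between the Binet forms of W_(sn) and W_s, the latter having
    numerator [c]. *)
Lemma ho_horadamE (n : nat) :
  ho_horadam alpha beta W0 W1 s n = c^-1 * (A * p ^+ n - B * q ^+ n).
Proof.
rewrite /ho_horadam /horadam -/A -/B !exprM -/p -/q -/c.
have := horadam_num_neq0; have : alpha - beta != 0 by rewrite subr_eq0.
by move=> ? ?; field; apply/andP.
Qed.

(** Coordinate r carries index n + r, and p^(n+r) = p^n p^r, where p^r is coordinate r of [Theta] at
    [alpha]; likewise for q and [beta]. *)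
Lemma ho_horadam_gquatE (n : nat) :
  ho_horadam_gquat l1 l2 l3 alpha beta W0 W1 s n
  = c^-1 *: (A *: (p ^+ n *: Theta l1 l2 l3 alpha s)
             - B *: (q ^+ n *: Theta l1 l2 l3 beta s)).
Proof.
rewrite !ThetaE mulnC [(3 * s)%N]mulnC !exprM -/p -/q.
pose w := ho_horadam alpha beta W0 W1 s.
transitivity (GQuat l1 l2 l3 (w n) (w n.+1) (w n.+2) (w n.+3)).
  by rewrite [RHS]gquatE.
rewrite /w !ho_horadamE.
by congr (GQuat l1 l2 l3 _ _ _ _); rewrite /= ?exprS; ring.
Qed.

Lemma horadam_gfE :
  horadam_gf l1 l2 l3 alpha beta W0 W1 s
  = c^-1 *: (A *: fps_geom p (Theta l1 l2 l3 alpha s)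
             - B *: fps_geom q (Theta l1 l2 l3 beta s)).
Proof. by apply: fpsP => n; apply: ho_horadam_gquatE. Qed.

End Binet.

Theorem theorem5p1 (R : realType) (l1 l2 l3 alpha beta W0 W1 : R) (s : nat) :
  alpha != 0 -> beta != 0 -> alpha != beta ->
  (1 <= s)%N -> horadam alpha beta W0 W1 s != 0 ->
  let A := W1 - W0 * beta in
  let B := W1 - W0 * alpha in
  let Ta := Theta l1 l2 l3 alpha s in
  let Tb := Theta l1 l2 l3 beta s in
  let x : fps (gquat l1 l2 l3) := fpsX in
  let num : fps (gquat l1 l2 l3) :=
    fpsC (A *: Ta - B *: Tb : gquat l1 l2 l3)
    - fpsC ((A * beta ^+ s) *: Ta - (B * alpha ^+ s) *: Tb : gquat l1 l2 l3)
      * x in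
  let den : fps (gquat l1 l2 l3) :=
    (A * alpha ^+ s - B * beta ^+ s) *:
    (1 - (alpha ^+ s + beta ^+ s) *: x + (alpha * beta) ^+ s *: x ^+ 2) in
  horadam_gf l1 l2 l3 alpha beta W0 W1 s = num / den.
Proof.
move=> _ _ neq_ab _ Ws0 A B Ta Tb x num den.
set p := alpha ^+ s in num den *; set q := beta ^+ s in num den *.
set c := A * p - B * q in den *.
have c0 : c != 0 by apply: horadam_num_neq0 Ws0.
have denE : den = c *: ((1 - p *: x) * (1 - q *: x)).
  by rewrite fps_linear_factorsM /p /q -exprMn.
have Uden : den \is a GRing.unit.
  by rewrite denE scaler_unit ?unitfE // unitrMl unit_fps_linear.
(* Quaternion series do not commute in general, but these two factors do, their coefficients being
   scalars. *)
have factC : (1 - p *: x) * (1 - q *: x) = (1 - q *: x) * (1 - p *: x).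
  by rewrite !fps_linear_factorsM [q + p]addrC [q * p]mulrC.
(* The quotient is [num * den^-1], so the denominator is cleared on the right. *)
apply: (canRL (mulrK Uden)).
rewrite horadam_gfE // -/A -/B -/p -/q -/c -/Ta -/Tb denE.
rewrite -scalerAr -scalerAl scalerA divff // scale1r.
(* Swapping the factors in the second summand only puts each geometric series next to its own
   factor; what remains is A Ta (1 - q x) - B Tb (1 - p x). *)
rewrite mulrBl -!scalerAl {2}factC !mulrA !fps_geomM.
(* Made opaque, [A] and [B] are atoms for the distributive rewriting below. *)
rewrite /num; clearbody A B.
rewrite !fpsCB_scale !mulrBl !mulrBr !mulr1 -!scalerAl -!scalerAr !scalerBr.
by rewrite !scalerA !opprB addrACA [RHS]addrACA [X in _ = _ + X]addrC.
Qed.
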